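(* Let $\beta,\gamma>0$ and let $\Lambda\subseteq\mathbb{R}$ be separated with $D^-(\Lambda)>2\beta^{-1}$. Then phase-retrieval is possible on $\Lambda$ for all real-valued functions in $V^\infty_\beta(\phi_\gamma)$: if $f,g\in V^\infty_\beta(\phi_\gamma)$ are real-valued and $|f(\lambda)|=|g(\lambda)|$ for all $\lambda\in\Lambda$, then either $g=f$ or $g=-f$.
   Context: For $\gamma>0$ let $\phi_\gamma(x)=e^{-\gamma x^2}$, $x\in\mathbb{R}$. For $\beta>0$, $V^\infty_\beta(\phi_\gamma)$ is the space of all functions $f:\mathbb{R}\to\mathbb{C}$ of the form $f(x)=\sum_{k\in\mathbb{Z}}c_k e^{-\gamma(x-\beta k)^2}$ with $c=(c_k)\in\ell^\infty(\mathbb{Z})$ (complex coefficients). A set $\Lambda\subseteq\mathbb{R}$ is separated if $\inf\{|\lambda-\lambda'|:\lambda,\lambda'\in\Lambda,\ \lambda\neq\lambda'\}>0$. The lower Beurling density is $D^-(\Lambda)=\liminf_{r\to\infty}\inf_{x\in\mathbb{R}}\frac{\#(\Lambda\cap[x-r,x+r])}{2r}$. *)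

(* Defs.v *)
From HB Require Import structures.
From mathcomp Require Import all_boot all_order all_algebra.
From mathcomp Require Import finmap.
From mathcomp Require Export complex.
From mathcomp Require Export all_classical all_reals all_analysis.
From mathcomp Require Import summability.
Import Order.TTheory GRing.Theory Num.Theory.
Import numFieldNormedType.Exports.

Set Implicit Arguments.
Unset Strict Implicit.
Unset Printing Implicit Defensive.

Local Open Scope classical_set_scope.
Local Open Scope ring_scope.
Local Open Scope complex_scope.

(* The library gives [R[i]] a norm but no topology; these instances supply the
   norm topology. *)
HB.instance Definition _ (R : realType) := GRing.ComAlgebra.copy R[i] R[i]^o.
HB.instance Definition _ (R : realType) := Vector.copy R[i] R[i]^o.
HB.instance Definition _ (R : realType) := NormedModule.copy R[i] R[i]^o.

Definition gaussian (R : realType) (gamma x : R) : R :=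
  expR (- gamma * x ^+ 2).

(* The sum over all integers is unordered: its partial sums run over the
   finite sets of integers, directed by inclusion. For a bounded [c] and a
   Gaussian [phi] the series converges absolutely. *)
Definition shift_invariant_space (R : realType) (beta : R) (phi : R -> R) :
    set (R -> R[i]) :=
  [set f | exists2 c : int -> R[i], bounded_fun c &
    forall x, partial_sum (fun k : int => c k * (phi (x - beta * k%:~R))%:C)
                @ totally --> f x].

(* For a set with at most one point the infimum is [+oo], so the set is separated. *)
Definition separated_set (R : realType) (L : set R) : Prop :=
  (0 < ereal_inf [set (`|p.1 - p.2|)%:E | p in
         [set p : R * R | [/\ L p.1, L p.2 & p.1 <> p.2]]])%E.

(* [counting] is [+oo] on infinite sets. *)
Definition lower_beurling_density (R : realType) (L : set R) : \bar R :=
  limf_einf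
    (fun r : R => ereal_inf
       [set (counting (L `&` `[(x - r)%R, (x + r)%R]) * ((2 * r)^-1)%:E)%E
         | x in [set: R]])
    (pinfty_nbhs R).

(* Main.v *)
Require Import Defs.
From mathcomp Require Import all_boot all_order all_algebra.
From mathcomp Require Import finmap ring lra zify.
From mathcomp Require Import complex summability.
From mathcomp Require Import all_classical all_reals all_analysis.
Import Order.TTheory GRing.Theory Num.Theory.
Import numFieldNormedType.Exports.
Local Open Scope classical_set_scope.
Local Open Scope ring_scope.
Local Open Scope complex_scope.

(** Put [p = f - g] and [q = f + g], real Gaussian series with [p * q = 0] on
    [Lambda]. Around a point [x], up to a factor depending on [t] only, a product of
    two Gaussian shifts evaluated at [x + t] is a multiple of [w ^ (k + l)] with
    [w = exp (2 gamma beta t)]. Given zeros [x + t_j] of [p * q], consider the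
    functional [h |-> h x - \sum_j a_j h (x + t_j)]; it sends [p * q] to
    [p x * q x], and it sends the power [w ^ k] to [u k = 1 - \sum_j a_j w_j ^ k].
    Adding the nodes one by one, the [a_j] can be chosen so that [|u k|] is at most
    [rho ^ |k|] times the product of the [(w_j - 1) / (rho - w_j)], over the nodes on
    each side of [x], where [rho = exp (2 gamma beta s)] dominates all nodes. The
    Gaussian weights cost [exp (2 gamma s ^ 2 + O(s))], while zeros of density
    [d] make the product [exp (- gamma beta d s ^ 2 + O(s))]; if
    [d > 2 / beta], letting [s] tend to infinity gives [p x * q x = 0] for all [x].
    Finally, the same estimate with [p = q], [s] fixed and many nodes on one side
    shows that a nonzero series has boundedly many zeros in a bounded interval, so
    that [p * q = 0] forces [p = 0] or [q = 0]. *)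

Set Implicit Arguments.
Unset Strict Implicit.
Unset Printing Implicit Defensive.

#[local] Existing Instance totally_filter.

(** * Exponential combinations with small values on the integers *)

Definition exp_combination (F : realFieldType) (X : seq F) (u : int -> F) : Prop :=
  exists a : F -> F, forall k, u k = 1 - \sum_(x <- X) a x * x ^ k.

(** The constants are kept apart because a node above 1 improves only [A] and a node below 1 only
    [B]. *)
Definition two_sided_bound (F : realFieldType) (rho A B : F) (u : int -> F) : Prop :=
  forall n : nat, `|u n| <= A * rho ^+ n /\ `|u (- n%:Z)| <= B * rho ^+ n.

(* The next value [v (k + 1) = y * v k + (1 - y) * u k] has the new node [y] as
   homogeneous solution and keeps the coefficient of the node [1] equal to [1]. *)
Lemma exp_combination_add_node (F : realFieldType) (rho A B y : F) (X : seq F)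
    (u : int -> F) :
  {in X, forall x, 0 < x} -> y \notin X -> 1 < y -> y < rho ->
  exp_combination X u -> two_sided_bound rho A B u ->
  exists2 v, exp_combination (y :: X) v &
    two_sided_bound rho (A * ((y - 1) / (rho - y))) B v.
Proof.
move=> X_gt0 yX y_gt1 y_rho [a ua] ub.
have y_gt0 : 0 < y by lra.
have y_neq0 : y != 0 by rewrite gt_eqF.
have rho_gt1 : 1 < rho by lra.
(* Comparing the coefficients of [x ^ k] in the recursion gives [b x * (x - y) = (1 - y) * a x]. *)
pose b x := a x * (1 - y) / (x - y).
pose C := 1 - \sum_(x <- X) b x.
(* [C] is chosen so that [v 0 = 0]; the recursion [vS] then propagates the bounds
   away from [0] in both directions. *)
pose v (k : int) := 1 - \sum_(x <- X) b x * x ^ k - C * y ^ k.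
have vS k : v (k + 1) = y * v k + (1 - y) * u k.
  rewrite /v ua expfzDr // expr1z.
  have -> : \sum_(x <- X) b x * x ^ (k + 1) =
      y * (\sum_(x <- X) b x * x ^ k) + (1 - y) * (\sum_(x <- X) a x * x ^ k).
    rewrite !mulr_sumr -big_split /=; apply: eq_big_seq => x xX.
    have x_neq0 : x != 0 by rewrite gt_eqF // X_gt0.
    have xy : x - y != 0 by rewrite subr_eq0; apply: contraNneq yX => <-.
    by rewrite expfzDr // expr1z /b; field.
  by ring.
have v0 : v 0 = 0.
  rewrite /v expr0z mulr1 /C (eq_bigr b) ?subrr // => x _.
  by rewrite expr0z mulr1.
exists v.
  exists (fun x => if x == y then C else b x) => k.
  rewrite big_cons eqxx /v; under [in RHS]eq_big_seq => x xX.
    have /negPf -> : x != y by apply: contraNneq yX => <-.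
    over.
  by rewrite opprD addrCA addrA [LHS]addrC; ring.
have A_ge0 : 0 <= A by have [] := ub 0; rewrite mulr1 => /(le_trans (normr_ge0 _)).
have B_ge0 : 0 <= B by have [] := ub 0; rewrite !mulr1 => _ /(le_trans (normr_ge0 _)).
have rhoy : 0 < rho - y by lra.
elim=> [|n [IHp IHn]].
  by rewrite oppr0 v0 normr0 !mulr1; split=> //; rewrite mulr_ge0 ?divr_ge0 //; lra.
split.
  have -> : (n.+1)%:Z = n%:Z + 1 by rewrite -addn1 PoszD.
  rewrite vS (le_trans (ler_normD _ _)) // !normrM (gtr0_norm y_gt0).
  rewrite (@ltr0_norm _ (1 - y)) ?subr_lt0 // opprB.
  have [ubp _] := ub n.
  apply: le_trans (lerD (ler_wpM2l (ltW y_gt0) IHp) (ler_wpM2l _ ubp)) _; first lra.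
  (* The new factor [K = (y - 1) / (rho - y)] solves [y * K + (y - 1) = rho * K]. *)
  rewrite exprS le_eqVlt; apply/orP; left; apply/eqP; field.
  by rewrite gt_eqF.
have [_ ubn] := ub n.+1.
(* Run backwards, the recursion has weights [1 / y] and [(y - 1) / y], which sum to 1, so [B]
   survives unchanged. *)
have -> : v (- (n.+1)%:Z) = (v (- n%:Z) + (y - 1) * u (- (n.+1)%:Z)) / y.
  have -> : - n%:Z = - (n.+1)%:Z + 1 by lia.
  by rewrite vS; field.
rewrite normrM normfV (gtr0_norm y_gt0) ler_pdivrMr //.
rewrite (le_trans (ler_normD _ _)) // normrM (@gtr0_norm _ (y - 1)) ?subr_gt0 //.
have rn : rho ^+ n <= rho ^+ n.+1 by rewrite ler_eXn2l.
have := ler_wpM2l B_ge0 rn => Brn.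
apply: le_trans (lerD (le_trans IHn Brn) (ler_wpM2l _ ubn)) _; first lra.
by rewrite le_eqVlt; apply/orP; left; apply/eqP; ring.
Qed.

Lemma exp_combination_add_nodes (F : realFieldType) (rho A B : F) (X Y : seq F)
    (u : int -> F) :
  {in X, forall x, 0 < x} -> uniq Y -> {in Y, forall y, y \notin X} ->
  {in Y, forall y, 1 < y < rho} ->
  exp_combination X u -> two_sided_bound rho A B u ->
  exists2 v, exp_combination (Y ++ X) v &
    two_sided_bound rho (A * \prod_(y <- Y) ((y - 1) / (rho - y))) B v.
Proof.
move=> X_gt0; elim: Y => [|y Y IH] /=.
  by move=> _ _ _ uX ub; exists u; rewrite // big_nil mulr1.
case/andP=> yY uY YX Yb uX ub.
have [||v vX vb] := IH uY _ _ uX ub.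
- by move=> z zY; apply: YX; rewrite inE zY orbT.
- by move=> z zY; apply: Yb; rewrite inE zY orbT.
have /andP[y1 y2] := Yb y (mem_head _ _).
have [||w wX wb] := exp_combination_add_node _ _ y1 y2 vX vb.
- move=> x; rewrite mem_cat => /orP[xY|/X_gt0//].
  by have /andP[? _] := Yb x ltac:(by rewrite inE xY orbT); lra.
- by rewrite mem_cat negb_or yY YX // mem_head.
by exists w => //; rewrite big_cons mulrA mulrAC.
Qed.

(** Reflection exchanges nodes above 1 with nodes below 1, so the one-sided construction serves both
    sides of the point. *)
Lemma exp_combination_reflect (F : realFieldType) (X : seq F) (u : int -> F) :
  exp_combination X u -> exp_combination [seq x^-1 | x <- X] (fun k => u (- k)).
Proof.
case=> a ua; exists (fun x => a x^-1) => k; rewrite ua big_map.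
by under [in RHS]eq_bigr do rewrite invrK exprz_inv.
Qed.

Lemma two_sided_bound_reflect (F : realFieldType) (rho A B : F) (u : int -> F) :
  two_sided_bound rho A B u -> two_sided_bound rho B A (fun k => u (- k)).
Proof. by move=> ub n; have [? ?] := ub n; rewrite opprK. Qed.

(** Start from the constant 1 without nodes, add [Z], reflect, then add [Y]. The inverses of [Z] lie
    below 1, hence differ from all of [Y]. *)
Lemma exp_combination_two_sided (F : realFieldType) (rho : F) (Y Z : seq F) :
  1 < rho -> uniq Y -> uniq Z ->
  {in Y, forall y, 1 < y < rho} -> {in Z, forall z, 1 < z < rho} ->
  exists2 u, exp_combination (Y ++ [seq z^-1 | z <- Z]) u &
    two_sided_bound rho (\prod_(y <- Y) ((y - 1) / (rho - y)))
      (\prod_(z <- Z) ((z - 1) / (rho - z))) u.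
Proof.
move=> rho1 uY uZ Yb Zb.
have u0 : exp_combination [::] (fun=> 1 : F).
  by exists (fun=> 0) => k; rewrite big_nil subr0.
have b0 : two_sided_bound rho 1 1 (fun=> 1 : F).
  by move=> n; rewrite normr1 !mul1r; split; apply: exprn_ege1; apply: ltW.
have [//|//|v vX /two_sided_bound_reflect vb] :=
  exp_combination_add_nodes _ uZ _ Zb u0 b0.
have Zi_lt1 x : x \in [seq z^-1 | z <- Z] -> 0 < x < 1.
  case/mapP=> z /Zb /andP[z1 _] ->; have z0 : 0 < z by lra.
  by rewrite invr_gt0 z0 invf_lt1.
have [||u uX ub] := exp_combination_add_nodes _ uY _ Yb
    (exp_combination_reflect vX) vb.
- by move=> x; rewrite cats0 => /Zi_lt1 /andP[].
- move=> y /Yb /andP[y1 _]; rewrite cats0; apply/negP => /Zi_lt1; lra.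
- by exists u; rewrite ?mul1r cats0 in uX ub *.
Qed.

(** * Gaussian weights and the estimate of a product of two series *)

Lemma expR_mulz (R : realType) (x : R) (k : int) : expR (x * k%:~R) = expR x ^ k.
Proof.
case: k => n; first by rewrite -pmulrn expRM_natr.
by rewrite NegzE mulrNz mulrN expRN -pmulrn expRM_natr.
Qed.

Lemma geometric_sum_le (R : realFieldType) (th : R) (l : seq nat) :
  0 <= th < 1 -> uniq l -> \sum_(n <- l) th ^+ n <= (1 - th)^-1.
Proof.
move=> /andP[th0 th1] ul; pose N := (\max_(n <- l) n).+1.
have lN n : n \in l -> (n < N)%N by move=> nl; rewrite ltnS; apply: leq_bigmax_seq.
apply: (@le_trans _ _ (\sum_(n <- iota 0 N) th ^+ n)).
  rewrite [leRHS](bigID (mem l)) /= -[\sum_(_ <- iota 0 N | _ \in l) _]big_filter.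
  have /(perm_big l) -> : perm_eq [seq n <- iota 0 N | n \in l] l.
    apply: uniq_perm => //; first by rewrite filter_uniq // iota_uniq.
    by move=> n; rewrite mem_filter mem_iota /=; case: (boolP (n \in l)) => //= /lN ->.
  by rewrite lerDl sumr_ge0 // => n _; rewrite exprn_ge0.
have -> : iota 0 N = index_iota 0 N by rewrite /index_iota subn0.
rewrite big_mkord -[leRHS]mul1r ler_pdivlMr ?subr_gt0 //.
have -> : (\sum_(i < N) th ^+ i) * (1 - th) = 1 - th ^+ N.
  by rewrite -[RHS]opprB subrX1; ring.
by rewrite gerDl oppr_le0 exprn_ge0.
Qed.

Lemma geometric_sum_absz_le (R : realFieldType) (th : R) (S : {fset int}) :
  0 <= th < 1 -> \sum_(k <- S) th ^+ `|k|%N <= 2 / (1 - th).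
Proof.
move=> th01; have half (P : pred int) : {in P &, injective absz} ->
    \sum_(k <- S | P k) th ^+ `|k|%N <= (1 - th)^-1.
  move=> Pinj; rewrite -big_filter -(big_map absz xpredT (fun n => th ^+ n)).
  apply: geometric_sum_le => //; rewrite map_inj_in_uniq ?filter_uniq ?fset_uniq //.
  by move=> k l; rewrite !mem_filter => /andP[kP _] /andP[lP _]; apply: Pinj.
rewrite (bigID (fun k : int => 0 <= k)) /= mulr_natl mulr2n lerD // half // => k l;
  rewrite -!topredE /=; lia.
Qed.

(** The Gaussian absorbs the growth [rho ^ |k|]. Completing the square with [s + 1] instead of [s]
    leaves a geometric factor, which makes the sum over [k] converge. *)
Lemma gaussian_weight_le (R : realType) (beta gamma s x : R) (k : int) :
  0 < beta -> 0 < gamma -> 0 <= s ->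
  gaussian gamma (x - beta * k%:~R) * expR (2 * gamma * beta * s) ^+ `|k|%N <=
  expR (gamma * ((s + 1) ^+ 2 + 2 * `|x| * (s + 1))) *
    expR (- (2 * gamma * beta)) ^+ `|k|%N.
Proof.
move=> b0 g0 s0; rewrite /gaussian -!expRM_natr -!expRD ler_expR.
have -> : `|k|%N%:R = `|k%:~R| :> R by rewrite -intr_norm -abszE.
set K : R := k%:~R.
have xK : x * K <= `|x| * `|K| by rewrite -normrM ler_norm.
(* the difference of the exponents is [gamma] times this square *)
have := sqr_ge0 (beta * `|K| - `|x| - (s + 1)).
have xx : x ^+ 2 = `|x| ^+ 2 by rewrite real_normK ?num_real.
have KK : K ^+ 2 = `|K| ^+ 2 by rewrite real_normK ?num_real.
move=> /(mulr_ge0 (ltW g0)) H.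
have gb : 0 < gamma * beta by rewrite mulr_gt0.
have := ler_wpM2l (ltW gb) xK.
have -> : - gamma * (x - beta * K) ^+ 2 =
   - gamma * x ^+ 2 + 2 * (gamma * beta * (x * K)) - gamma * beta ^+ 2 * K ^+ 2 by ring.
rewrite xx KK => H2.
apply: le_trans (_ : - gamma * `|x| ^+ 2 + 2 * (gamma * beta * (`|x| * `|K|)) -
  gamma * beta ^+ 2 * `|K| ^+ 2 + 2 * gamma * beta * s * `|K| <= _).
  by lra.
rewrite -subr_ge0; apply: le_trans H _; rewrite le_eqVlt; apply/orP; left; apply/eqP; ring.
Qed.

Definition gaussian_series (R : realType) (beta gamma : R) (c : int -> R)
    (p : R -> R) : Prop :=
  forall x, partial_sum (fun k => c k * gaussian gamma (x - beta * k%:~R))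
              @ totally --> p x.

Lemma gaussian_translateM (R : realType) (beta gamma x t : R) (k l : int) :
  gaussian gamma (x + t - beta * k%:~R) * gaussian gamma (x + t - beta * l%:~R) *
    expR (2 * gamma * t ^+ 2 + 4 * gamma * t * x) =
  gaussian gamma (x - beta * k%:~R) * gaussian gamma (x - beta * l%:~R) *
    expR (2 * gamma * beta * t) ^ (k + l).
Proof.
rewrite /gaussian -expR_mulz -!expRD; congr expR; rewrite intrD; ring.
Qed.

Lemma gaussian_series_mul_le (R : realType) (beta gamma C D s x eps : R)
    (c d : int -> R) (p q : R -> R) (T : seq R) (u : int -> R) :
  0 < beta -> 0 < gamma -> 0 <= s ->
  (forall k, `|c k| <= C) -> (forall k, `|d k| <= D) ->
  gaussian_series beta gamma c p -> gaussian_series beta gamma d q ->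
  exp_combination [seq expR (2 * gamma * beta * t) | t <- T] u ->
  {in T, forall t, p (x + t) * q (x + t) = 0} ->
  (forall k, `|u k| <= eps * expR (2 * gamma * beta * s) ^+ `|k|%N) ->
  `|p x * q x| <= eps * (C * D * (expR (gamma * ((s + 1) ^+ 2 + 2 * `|x| * (s + 1))) *
     (2 / (1 - expR (- (2 * gamma * beta))))) ^+ 2).
Proof.
move=> b0 g0 s0 cC dD cp dq [a ua] pq0 ub.
pose P (S : {fset int}) y := partial_sum (fun k => c k * gaussian gamma (y - beta * k%:~R)) S.
pose Q (S : {fset int}) y := partial_sum (fun k => d k * gaussian gamma (y - beta * k%:~R)) S.
pose w t := expR (2 * gamma * beta * t).
pose e t := expR (2 * gamma * t ^+ 2 + 4 * gamma * t * x).
(* This is the functional applied to products of partial sums. In the limit its node terms vanish,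
   while for finite [S] each pair [k], [l] contributes a multiple of [u (k + l)]. *)
pose L (S : {fset int}) := P S x * Q S x -
  \sum_(t <- T) a (w t) * e t * (P S (x + t) * Q S (x + t)).
set rho := expR (2 * gamma * beta * s) in ub *.
set th := expR (- (2 * gamma * beta)).
set E := expR (gamma * _).
have th01 : 0 <= th < 1.
  by rewrite expR_ge0 /= /th -[ltRHS]expR0 ltr_expR oppr_lt0 !mulr_gt0.
have rho1 : 1 <= rho.
  by rewrite /rho -[leLHS]expR0 ler_expR !mulr_ge0 // ltW.
have C0 : 0 <= C := le_trans (normr_ge0 _) (cC 0).
have D0 : 0 <= D := le_trans (normr_ge0 _) (dD 0).
have eps0 : 0 <= eps.
  by have := le_trans (normr_ge0 _) (ub 0); rewrite expr0 mulr1.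
have Lcvg : L S @[S --> totally] --> p x * q x.
  rewrite -[X in _ --> X]subr0 -[X in _ - X](_ :
      \sum_(t <- T) a (w t) * e t * (p (x + t) * q (x + t)) = 0).
    apply: cvgB; first exact: cvgM (cp x) (dq x).
    elim: (T) => [|t T' IH].
      rewrite big_nil; under eq_fun do rewrite big_nil; exact: cvg_cst.
    rewrite big_cons; under eq_fun do rewrite big_cons.
    apply: cvgD IH; apply: cvgMr; exact: cvgM (cp _) (dq _).
  by apply: big1_seq => t /= /pq0 ->; rewrite mulr0.
have LE S : L S = \sum_(k : S) \sum_(l : S)
    c (val k) * gaussian gamma (x - beta * (val k)%:~R) *
    (d (val l) * gaussian gamma (x - beta * (val l)%:~R)) * u (val k + val l).
  rewrite /L /P /Q /partial_sum big_distrlr /=.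
  under [X in _ - X]eq_bigr => t _.
    rewrite big_distrlr /= mulr_sumr; under eq_bigr do rewrite mulr_sumr.
    over.
  rewrite [X in _ - X = _]exchange_big /= -sumrB; apply: eq_bigr => k _.
  rewrite [X in _ - X = _]exchange_big /= -sumrB; apply: eq_bigr => l _.
  rewrite ua mulrBr mulr1; congr (_ - _).
  rewrite big_map mulr_sumr; apply: eq_bigr => t _.
  have := gaussian_translateM beta gamma x t (val k) (val l).
  rewrite -/(e t) -/(w t) => H.
  transitivity (c (val k) * d (val l) * a (w t) *
    (gaussian gamma (x + t - beta * (val k)%:~R) *
     gaussian gamma (x + t - beta * (val l)%:~R) * e t)); first ring.
  by rewrite H; ring.
set M := _ * (C * D * _).
have LM S : `|L S| <= M.
  rewrite LE; apply: le_trans (ler_norm_sum _ _ _) _.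
  apply: (@le_trans _ _ (\sum_(k : S) \sum_(l : S)
      eps * (C * (E * th ^+ `|val k|%N)) * (D * (E * th ^+ `|val l|%N)))).
    apply: ler_sum => k _; apply: le_trans (ler_norm_sum _ _ _) _.
    apply: ler_sum => l _; rewrite !normrM.
    have G0 y : 0 <= gaussian gamma y by rewrite /gaussian expR_ge0.
    (* Since [|k + l| <= |k| + |l|] and [rho >= 1], the growth of [u] splits between the two
       Gaussian weights. *)
    have uE : `|u (val k + val l)| <= eps * (rho ^+ `|val k|%N * rho ^+ `|val l|%N).
      apply: le_trans (ub _) _; rewrite ler_wpM2l // -exprD.
      by rewrite ler_weXn2l //; lia.
    rewrite !(ger0_norm (G0 _)).
    apply: le_trans (ler_wpM2l _ uE) _; first by rewrite !mulr_ge0.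
    have K1 := gaussian_weight_le x (val k) b0 g0 s0.
    have K2 := gaussian_weight_le x (val l) b0 g0 s0.
    have R0 n : 0 <= rho ^+ n by rewrite exprn_ge0 // expR_ge0.
    have K3 := ler_pM (normr_ge0 _) (mulr_ge0 (G0 _) (R0 _)) (cC (val k)) K1.
    have K4 := ler_pM (normr_ge0 _) (mulr_ge0 (G0 _) (R0 _)) (dD (val l)) K2.
    have K5 := ler_pM (mulr_ge0 (normr_ge0 _) (mulr_ge0 (G0 _) (R0 _)))
      (mulr_ge0 (normr_ge0 _) (mulr_ge0 (G0 _) (R0 _))) K3 K4.
    rewrite -[leRHS]mulrA; apply: le_trans (ler_wpM2l eps0 K5).
    by rewrite le_eqVlt; apply/orP; left; apply/eqP; rewrite /rho; ring.
  have -> : \sum_(k : S) \sum_(l : S)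
      eps * (C * (E * th ^+ `|val k|%N)) * (D * (E * th ^+ `|val l|%N)) =
      eps * (C * D * (E * \sum_(k <- S) th ^+ `|k|%N) ^+ 2).
    rewrite big_seq_fsetE /= [RHS](_ : _ = eps * C * D * E * E *
      ((\sum_(k : S) th ^+ `|val k|%N) * (\sum_(k : S) th ^+ `|val k|%N))); last by ring.
    rewrite big_distrlr /= !mulr_sumr.
    apply: eq_bigr => k _; rewrite !mulr_sumr; apply: eq_bigr => l _; ring.
  have := geometric_sum_absz_le S th01; set Z := \sum_(_ <- _) _ => ZE.
  have Z0 : 0 <= Z.
    by apply: sumr_ge0 => k _; rewrite exprn_ge0 // expR_ge0.
  rewrite /M !ler_wpM2l ?mulr_ge0 // ler_sqr ?nnegrE ?mulr_ge0 ?expR_ge0 //.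
    by rewrite ler_wpM2l // expR_ge0.
  by rewrite invr_ge0; lra.
apply: (closed_cvg (fun y => y <= M) (@closed_le R M) _ _ (cvg_norm Lcvg)).
by apply: nearW.
Qed.

(** * Zeros of high density force the product to vanish *)

(** With [z = expR (om * (s - t))] the quotient is at most [1 / (z - 1)]. The gap [t + 1 <= s] gives
    [z >= expR om], so [z - 1] is at least the fraction [1 - expR (- om)] of [z]. *)
Lemma node_factor_le (R : realType) (om s t : R) : 0 < om -> 0 < t -> t + 1 <= s ->
  (expR (om * t) - 1) / (expR (om * s) - expR (om * t)) <=
  (1 - expR (- om))^-1 * expR (- (om * (s - t))).
Proof.
move=> om0 t0 ts; set y := expR (om * t); set z := expR (om * (s - t)).
have y0 : 0 < y by exact: expR_gt0.
have z0 : 0 < z by exact: expR_gt0.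
have th1 : expR (- om) < 1 by rewrite -expR0 ltr_expR oppr_lt0.
have -> : expR (om * s) = z * y by rewrite -expRD; congr expR; ring.
rewrite [expR (- (om * (s - t)))]expRN -/z -invfM; have zz : z^-1 <= expR (- om).
  by rewrite /z -expRN ler_expR lerN2; apply: ler_peMr; lra.
have z1 : (1 - expR (- om)) * z <= z - 1.
  have : z * z^-1 <= z * expR (- om) by rewrite ler_wpM2l // ltW.
  rewrite divff ?gt_eqF //; lra.
have z2 : 0 < (1 - expR (- om)) * z by rewrite mulr_gt0 // subr_gt0.
have d0 : 0 < z * y - y by rewrite -[X in _ - X]mul1r -mulrBl mulr_gt0 //; lra.
rewrite ler_pdivrMr // mulrC ler_pdivlMr //.
have := ler_wpM2l (ltW y0) z1; lra.
Qed.

Lemma node_prod_le (R : realType) (om s : R) (T : seq R) : 0 < om ->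
  {in T, forall t, 0 < t /\ t + 1 <= s} ->
  \prod_(y <- [seq expR (om * t) | t <- T]) ((y - 1) / (expR (om * s) - y)) <=
  (1 - expR (- om))^-1 ^+ size T * expR (- (om * ((size T)%:R * s - \sum_(t <- T) t))).
Proof.
move=> om0; elim: T => [|t T IH] Tb.
  by rewrite !big_nil mul0r subrr mulr0 oppr0 expR0 mulr1.
have [t0 ts] := Tb t (mem_head _ _).
rewrite map_cons !big_cons /=.
have e1 : (1 - expR (- om))^-1 ^+ (size T).+1 *
  expR (- (om * ((size T).+1%:R * s - (t + \sum_(t <- T) t)))) =
  ((1 - expR (- om))^-1 * expR (- (om * (s - t)))) *
  ((1 - expR (- om))^-1 ^+ size T * expR (- (om * ((size T)%:R * s - \sum_(t <- T) t)))).
  rewrite exprS mulrACA -expRD; congr (_ * expR _).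
  by rewrite -natr1; ring.
have fact0 r : 0 < r -> r + 1 <= s ->
    0 <= (expR (om * r) - 1) / (expR (om * s) - expR (om * r)).
  move=> r0 rs; rewrite divr_ge0 // subr_ge0.
    by rewrite -expR0 ler_expR mulr_ge0 // ltW.
  by rewrite ler_expR ler_pM2l //; lra.
rewrite e1; apply: ler_pM; rewrite ?node_factor_le ?fact0 //.
  rewrite big_map big_seq prodr_ge0 // => r rT.
  by have [? ?] := Tb r ltac:(by rewrite inE rT orbT); apply: fact0.
by apply: IH => r rT; apply: Tb; rewrite inE rT orbT.
Qed.

(** Take [n] points from each of [m] consecutive blocks and bound each point by the right end of its
    block; the ends add up to a triangular number times [L]. *)
Lemma block_points (R : realType) (P : set R) (n : nat) (L x : R) (m : nat) :
  0 < L ->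
  (forall y, exists l : seq R,
     [/\ uniq l, size l = n & {in l, forall t, P t /\ y < t < y + L}]) ->
  exists T : seq R, [/\ uniq T, size T = (n * m)%N,
    {in T, forall t, P (x + t) /\ 0 < t < m%:R * L} &
    \sum_(t <- T) t <= n%:R * L * (m%:R * (m%:R + 1) / 2)].
Proof.
move=> L0 HP; elim: m => [|m [T [uT sT bT ST]]].
  by exists [::]; split; rewrite ?muln0 // big_nil !mul0r mulr0.
have [l [ul sl bl]] := HP (x + m%:R * L).
have ll t : t \in l -> m%:R * L < t - x < m.+1%:R * L.
  by move=> /bl[_ /andP[? ?]]; rewrite -natr1; lra.
have mL : 0 <= m%:R * L by rewrite mulr_ge0 // ltW.
exists ([seq t - x | t <- l] ++ T); split.
- rewrite cat_uniq uT map_inj_uniq ?ul /=; last exact: addIr.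
  rewrite andbT -all_predC; apply/allP => t /bT [_ /andP[_ tm]] /=.
  by apply/mapP => -[r /ll rl] E; move: rl tm; rewrite -E; lra.
- by rewrite size_cat size_map sl sT mulnS.
- move=> t; rewrite mem_cat => /orP[/mapP[r rl ->]|/bT[? ?]].
    by rewrite addrC subrK; split; [have [] := bl r rl|have := ll r rl; lra].
  by split=> //; rewrite -natr1; lra.
rewrite big_cat /= big_map.
have Sl : \sum_(t <- l) (t - x) <= n%:R * (m.+1%:R * L).
  rewrite -sl mulr_natl -sum1_size -sumrMnr big_seq [leRHS]big_seq.
  by apply: ler_sum => t /ll; lra.
by apply: le_trans (lerD Sl ST) _; rewrite -natr1 le_eqVlt; apply/orP; left; apply/eqP; field.
Qed.

Lemma gaussian_decay_le0 (R : realType) (D M a b c : R) : 0 < a -> 0 <= M ->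
  (forall m : nat, D <= M * expR (- a * m%:R ^+ 2 + b * m%:R + c)) -> D <= 0.
Proof.
move=> a0 M0 HD; rewrite leNgt; apply/negP => D0.
(* For [m > B] the first term brings the exponent below [- m], the second gives
   [M < D * (1 + m) <= D * expR m], and the last ensures [m >= 1]. *)
pose B := (`|b| + `|c| + 1) / a + M / D + 1.
have B0 : 0 <= (`|b| + `|c| + 1) / a by rewrite divr_ge0 ?addr_ge0 // ltW.
have MD : 0 <= M / D by rewrite divr_ge0 // ltW.
pose m := (Num.trunc B).+1.
have mB : B < m%:R by apply: truncnS_gt.
have m1 : 1 <= m%:R :> R by rewrite /B in mB; lra.
have ma : `|b| + `|c| + 1 <= a * m%:R.
  by rewrite mulrC -ler_pdivrMr //; rewrite /B in mB; lra.
have H : - a * m%:R ^+ 2 + b * m%:R + c <= - m%:R.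
  have := ler_wpM2r (ltW (lt_le_trans ltr01 m1)) ma.
  have := ler_wpM2r (ltW (lt_le_trans ltr01 m1)) (ler_norm b).
  have := ler_wpM2l (normr_ge0 c) m1.
  have := ler_norm c; lra.
have : M * expR (- m%:R) < D.
  rewrite expRN ltr_pdivrMr ?expR_gt0 //.
  apply: lt_le_trans (ler_wpM2l (ltW D0) (expR_ge1Dx m%:R)).
  by rewrite -ltr_pdivrMl // mulrC; rewrite /B in mB; lra.
apply/negP; rewrite -leNgt; apply: le_trans (HD m) _.
by rewrite ler_wpM2l // ler_expR.
Qed.

Lemma two_sided_bound_absz (F : realFieldType) (rho A B eps : F) (u : int -> F) :
  0 <= rho -> A <= eps -> B <= eps -> two_sided_bound rho A B u ->
  forall k, `|u k| <= eps * rho ^+ `|k|%N.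
Proof.
move=> rho0 Ae Be ub k.
have [uA uB] := ub `|k|%N.
have [k0|k0] := leP 0 k.
  rewrite gez0_abs // in uA; apply: le_trans uA _.
  by rewrite ler_wpM2r // exprn_ge0.
rewrite ltz0_abs // opprK in uB; apply: le_trans uB _.
by rewrite ler_wpM2r // exprn_ge0.
Qed.

(** Every block of length [L] holds [n] points, and [2 * L < beta * n] says that their density
    [n / L] exceeds [2 / beta]. Using [m] blocks on each side of [x], let [m] tend to infinity. *)
Lemma gaussian_series_mul_eq0 (R : realType) (beta gamma C D L : R) (n : nat)
    (c d : int -> R) (p q : R -> R) (Lambda : set R) :
  0 < beta -> 0 < gamma -> 0 < L -> 2 * L < beta * n%:R ->
  (forall k, `|c k| <= C) -> (forall k, `|d k| <= D) ->
  gaussian_series beta gamma c p -> gaussian_series beta gamma d q ->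
  (forall y, exists l : seq R,
     [/\ uniq l, size l = n & {in l, forall t, Lambda t /\ y < t < y + L}]) ->
  (forall l, Lambda l -> p l * q l = 0) ->
  forall x, p x * q x = 0.
Proof.
move=> b0 g0 L0 Ln cC dD cp dq HL pq0 x.
set om := 2 * gamma * beta.
have om0 : 0 < om by rewrite !mulr_gt0.
(* The nodes to the left of [x] are found as nodes to the right of [- x] for the reflected set. *)
have HLN y : exists l : seq R,
    [/\ uniq l, size l = n & {in l, forall t, Lambda (- t) /\ y < t < y + L}].
  have [l [ul sl bl]] := HL (- y - L).
  exists [seq - t | t <- l]; split; first by rewrite map_inj_uniq //; apply: oppr_inj.
    by rewrite size_map.
  by move=> _ /mapP[t /bl[? /andP[? ?]] ->]; rewrite opprK; split=> //; lra.
pose kap := (1 - expR (- om))^-1.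
have kap0 : 0 < kap by rewrite invr_gt0 subr_gt0 -expR0 ltr_expR oppr_lt0.
have C0 : 0 <= C := le_trans (normr_ge0 _) (cC 0).
have D0 : 0 <= D := le_trans (normr_ge0 _) (dD 0).
set X := `|x|.
pose Q (m : R) := ln kap * (n%:R * m) - om * (n%:R * m * (m * L + 1) -
  n%:R * L * (m * (m + 1) / 2)) +
  (gamma * ((m * L + 1 + 1) ^+ 2 + 2 * X * (m * L + 1 + 1))) *+ 2.
have bound (m : nat) : `|p x * q x| <= C * D * (2 * kap) ^+ 2 * expR (Q m%:R).
  (* All nodes lie below [m * L]; the extra 1 is the gap that [node_factor_le] requires. *)
  pose s := m%:R * L + 1.
  have s0 : 0 <= s by rewrite addr_ge0 // mulr_ge0 // ltW.
  have [Y [uY sY bY SY]] := block_points x m L0 HL.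
  have [Z [uZ sZ bZ SZ]] := block_points (- x) m L0 HLN.
  have nodes (T : seq R) (P : R -> Prop) : {in T, forall t, P t /\ 0 < t < m%:R * L} ->
      {in [seq expR (om * t) | t <- T], forall y, 1 < y < expR (om * s)}.
    move=> bT _ /mapP[t /bT[_ /andP[t0 tm]] ->].
    by rewrite -expR0 !ltr_expR ltr_pM2l // mulr_gt0 //= /s; lra.
  have uexp (T : seq R) : uniq T -> uniq [seq expR (om * t) | t <- T].
    by move=> uT; rewrite map_inj_uniq // => r t /expR_inj /mulfI; apply; rewrite gt_eqF.
  have rho1 : 1 < expR (om * s).
    rewrite -expR0 ltr_expR mulr_gt0 // /s ltr_wpDl // mulr_ge0 // ltW //.
  have [u uX ub] := exp_combination_two_sided rho1 (uexp _ uY) (uexp _ uZ)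
    (nodes _ _ bY) (nodes _ _ bZ).
  pose eps := kap ^+ (n * m) *
    expR (- (om * (n%:R * m%:R * s - n%:R * L * (m%:R * (m%:R + 1) / 2)))).
  have prodle (T : seq R) (P : R -> Prop) : {in T, forall t, P t /\ 0 < t < m%:R * L} ->
      size T = (n * m)%N -> \sum_(t <- T) t <= n%:R * L * (m%:R * (m%:R + 1) / 2) ->
      \prod_(y <- [seq expR (om * t) | t <- T]) ((y - 1) / (expR (om * s) - y)) <= eps.
    move=> bT sT ST; apply: le_trans (node_prod_le om0 _) _.
      by move=> t /bT[_ /andP[? ?]]; split=> //; rewrite /s; lra.
    rewrite sT -/kap ler_wpM2l ?exprn_ge0 ?(ltW kap0) // ler_expR lerN2 ler_pM2l //.
    by rewrite natrM lerD2l lerN2.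
  have ue := two_sided_bound_absz (ltW (lt_trans ltr01 rho1)) (prodle _ _ bY sY SY)
    (prodle _ _ bZ sZ SZ) ub.
  have := @gaussian_series_mul_le R beta gamma C D s x eps c d p q
    (Y ++ [seq - t | t <- Z]) u b0 g0 s0 cC dD cp dq.
  rewrite map_cat -map_comp.
  have -> : [seq ((fun t => expR (2 * gamma * beta * t)) \o -%R) i | i <- Z] =
      [seq z^-1 | z <- [seq expR (om * t) | t <- Z]].
    by rewrite -map_comp; apply: eq_map => t /=; rewrite mulrN expRN.
  move=> /(_ uX) H; apply: le_trans (H _ ue) _.
    move=> t; rewrite mem_cat => /orP[/bY[]|/mapP[z /bZ[? _] ->]].
      by move=> ? _; apply: pq0.
    by rewrite (_ : x - z = - (- x + z)); [apply: pq0 | ring].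
  rewrite -/om -/kap -/X le_eqVlt; apply/orP; left; apply/eqP.
  have -> : expR (Q m%:R) = eps * expR (gamma * ((s + 1) ^+ 2 + 2 * X * (s + 1))) ^+ 2.
    rewrite /Q /eps -natrM 2!expRD expRM_natr lnK //.
    by rewrite -[(gamma * _) *+ 2]mulr_natr expRM_natr.
  by rewrite /kap; ring.
apply/eqP; rewrite -normr_le0.
(* These are the coefficients of [Q] as a polynomial in [m]. In [a], the node product gives
   [gamma * beta * n * L] and the squared Gaussian weight costs [2 * gamma * L ^ 2], so the density
   hypothesis makes [a] positive. *)
pose a := gamma * L * (beta * n%:R - 2 * L).
pose b := ln kap * n%:R - om * n%:R + om * n%:R * L / 2 + 8 * gamma * L + 4 * gamma * X * L.
pose e := 8 * gamma + 8 * gamma * X.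
apply: (@gaussian_decay_le0 _ _ (C * D * (2 * kap) ^+ 2) a b e).
- by rewrite !mulr_gt0 // subr_gt0.
- by rewrite mulr_ge0 ?sqr_ge0 ?mulr_ge0.
move=> m; have -> : - a * m%:R ^+ 2 + b * m%:R + e = Q m%:R; last exact: bound.
by rewrite /Q /a /b /e /om; field.
Qed.

(** * Zeros of one series in a bounded interval *)

Lemma exp_combination_shift (F : realFieldType) (X : seq F) (u : int -> F) (m : int) :
  {in X, forall x, 0 < x} ->
  exp_combination X u -> exp_combination X (fun k => u (k + m)).
Proof.
move=> X0 [a ua]; exists (fun x => a x * x ^ m) => k; rewrite ua; congr (_ - _).
apply: eq_big_seq => x xX; rewrite expfzDr ?gt_eqF ?X0 //; ring.
Qed.

(** If [k + K >= 0], one of the two factors [rho ^ - K] pays for [|k + K| <= |k| + K]. If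
    [k + K < 0], then [|k + K| = |k| - K] already yields the gain. *)
Lemma two_sided_bound_shift (F : realFieldType) (rho A : F) (K : nat) (u : int -> F) :
  1 <= rho -> A <= (rho ^+ K)^-1 ^+ 2 -> two_sided_bound rho A 1 u ->
  forall k, `|u (k + K%:Z)| <= (rho ^+ K)^-1 * rho ^+ `|k|%N.
Proof.
move=> rho1 AK ub k; have rho0 : 0 < rho by lra.
have rK0 : rho ^+ K != 0 by rewrite expf_neq0 // gt_eqF.
have rn0 n : 0 <= rho ^+ n by rewrite exprn_ge0 // ltW.
have [uA uB] := ub (absz (k + K%:Z)).
have [k0|k0] := leP 0 (k + K%:Z).
  rewrite gez0_abs // in uA; apply: le_trans uA _.
  apply: le_trans (ler_wpM2r (rn0 _) AK) _.
  rewrite expr2 -mulrA ler_wpM2l ?invr_ge0 // ler_pdivrMl ?lt0r ?rK0 ?rn0 //.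
  by rewrite -exprD ler_weXn2l //; lia.
rewrite ltz0_abs // opprK mul1r in uB; apply: le_trans uB _.
rewrite ler_pdivlMl ?lt0r ?rK0 ?rn0 // -exprD ler_weXn2l //; lia.
Qed.

Lemma gaussian_series_zeros_bounded (R : realType) (beta gamma C w x : R)
    (c : int -> R) (p : R -> R) :
  0 < beta -> 0 < gamma -> 0 <= w -> (forall k, `|c k| <= C) ->
  gaussian_series beta gamma c p -> p x != 0 ->
  exists N : nat, forall l : seq R, uniq l ->
    {in l, forall t, p t = 0 /\ x < t < x + w} -> (size l < N)%N.
Proof.
move=> b0 g0 w0 cC cp px.
set om := 2 * gamma * beta.
have om0 : 0 < om by rewrite !mulr_gt0.
(* The term [2 / om] makes [rho] at least [3 * expR (om * w)], so every node factor is at most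
   1/2. *)
pose s := w + 2 / om; pose rho := expR (om * s).
have s0 : 0 <= s by rewrite addr_ge0 // divr_ge0 // ltW.
have rho3 : 3 * expR (om * w) <= rho.
  rewrite /rho /s mulrDr mulrCA divff ?gt_eqF // mulr1 expRD mulrC.
  by rewrite ler_wpM2l ?expR_ge0 //; have := expR_ge1Dx (2 : R); lra.
have w1 : 1 <= expR (om * w) by rewrite -expR0 ler_expR mulr_ge0 // ltW.
have rho2 : 2 <= rho by lra.
have rhok k : k%:R <= rho ^+ k.
  have : (2 : R) ^+ k <= rho ^+ k by rewrite lerXn2r // nnegrE; lra.
  by apply: le_trans; rewrite -natrX ler_nat ltnW // ltn_expl.
set M := C * C * (expR (gamma * ((s + 1) ^+ 2 + 2 * `|x| * (s + 1))) *
     (2 / (1 - expR (- om)))) ^+ 2.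
have P0 : 0 < `|p x * p x| by rewrite normr_gt0 mulf_neq0.
(* As [rho ^ K >= K], this [K] makes [M / rho ^ K] smaller than [|p x * p x|]. Then
   [N > rho ^ (2 K)] and [2 ^ N > N] bring the node product below [rho ^ (- 2 K)]. *)
pose K := (Num.trunc (M / `|p x * p x|)).+1.
have KM : M < K%:R * `|p x * p x| by rewrite -ltr_pdivrMr // truncnS_gt.
pose N := (Num.trunc ((rho ^+ K) ^+ 2)).+1.
exists N => l ul bl; rewrite ltnNge; apply/negP => Nl.
pose T := [seq t - x | t <- l].
have bT t : t \in T -> p (x + t) = 0 /\ 0 < t < w.
  by case/mapP => r /bl[pr /andP[r1 r2]] ->; rewrite addrC subrK; split=> //; lra.
pose Y := [seq expR (om * t) | t <- T].
have uY : uniq Y.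
  rewrite map_inj_uniq; last by move=> ? ? /expR_inj /mulfI; apply; rewrite gt_eqF.
  by rewrite map_inj_uniq //; apply: addIr.
have bY : {in Y, forall y, 1 < y < expR (om * w)}.
  move=> _ /mapP[t /bT[_ /andP[t0 tw]] ->].
  by rewrite -expR0 !ltr_expR ltr_pM2l // mulr_gt0.
have bY' : {in Y, forall y, 1 < y < rho} by move=> y /bY /andP[? ?]; lra.
have [||u uX ub] := exp_combination_two_sided _ uY (isT : uniq [::]) bY' _ => //; first by lra.
rewrite cats0 in uX; rewrite big_nil in ub.
have AK : \prod_(y <- Y) ((y - 1) / (rho - y)) <= (rho ^+ K)^-1 ^+ 2.
  apply: (@le_trans _ _ (2^-1 ^+ size Y)).
    elim: (Y) bY => [|y Z IH] bZ; first by rewrite big_nil.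
    have /andP[y1 yw] := bZ y (mem_head _ _).
    have fac0 z : 1 < z < expR (om * w) -> 0 <= (z - 1) / (rho - z).
      by move=> /andP[? ?]; rewrite divr_ge0 //; lra.
    rewrite big_cons exprS; apply: ler_pM; first by apply: fac0; rewrite y1.
    - by rewrite big_seq prodr_ge0 // => z zZ; apply/fac0/bZ; rewrite inE zZ orbT.
    - by rewrite ler_pdivrMr; lra.
    - by apply: IH => z zZ; apply: bZ; rewrite inE zZ orbT.
  rewrite !exprVn lef_pV2 ?posrE ?exprn_gt0 //; try lra.
  apply: le_trans (ltW (truncnS_gt _)) _.
  rewrite -natrX ler_nat !size_map; apply: leq_trans Nl _.
  exact/ltnW/ltn_expl.
(* Only the bound for [k >= 0] became small; shifting by [K] balances it against the
   trivial bound [rho ^ - k] for [k < 0]. *)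
have uX' : exp_combination Y (fun k => u (k + K%:Z)).
  by apply: exp_combination_shift uX => y /bY /andP[? _]; lra.
have ub' := two_sided_bound_shift _ AK ub.
have rK0 : 0 < rho ^+ K by rewrite exprn_gt0 //; lra.
have := gaussian_series_mul_le b0 g0 s0 cC cC cp cp uX' _ (ub' _).
move=> /(_ x); rewrite -/om -/M => H.
have : `|p x * p x| <= (rho ^+ K)^-1 * M.
  by apply: H; [move=> t /bT[-> _]; rewrite mul0r | lra].
apply/negP; rewrite -ltNge mulrC ltr_pdivrMr //.
by apply: lt_le_trans KM _; rewrite mulrC ler_wpM2l // rhok.
Qed.

(** By pigeonhole: if neither series vanished identically, enough points in a unit interval to the
    right of both nonzeros would give too many zeros of one factor. *)
Lemma gaussian_series_integral (R : realType) (beta gamma C D : R)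
    (c d : int -> R) (p q : R -> R) :
  0 < beta -> 0 < gamma ->
  (forall k, `|c k| <= C) -> (forall k, `|d k| <= D) ->
  gaussian_series beta gamma c p -> gaussian_series beta gamma d q ->
  (forall x, p x * q x = 0) -> (forall x, p x = 0) \/ (forall x, q x = 0).
Proof.
move=> b0 g0 cC dD cp dq pq0.
have [[x px]|p0] := pselect (exists x, p x != 0); last first.
  by left=> x; apply/eqP/contraT => px; case: p0; exists x.
right=> y; apply/eqP/contraT => qy.
pose m := Num.max x y.
have mx : x <= m by rewrite le_max lexx.
have my : y <= m by rewrite le_max lexx orbT.
have [Np HNp] := @gaussian_series_zeros_bounded R beta gamma C (m + 1 - x) x c p b0 g0
  ltac:(lra) cC cp px.
have [Nq HNq] := @gaussian_series_zeros_bounded R beta gamma D (m + 1 - y) y d q b0 g0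
  ltac:(lra) dD dq qy.
pose N := (Np + Nq)%N.
pose t (i : nat) := m + i.+1%:R / N.+1%:R.
have N0 : 0 < N.+1%:R :> R by [].
have tinj : injective t.
  move=> i j /addrI /mulIf; rewrite invr_eq0 gt_eqF // => /(_ isT) /eqP.
  by rewrite eqr_nat => /eqP[].
pose l := [seq t i | i <- iota 0 N].
have ul : uniq l by rewrite map_inj_uniq // iota_uniq.
have bl r : r \in l -> m < r < m + 1.
  case/mapP => i; rewrite mem_iota /= add0n => iN ->.
  rewrite /t ltrDl divr_gt0 //= ltrD2l ltr_pdivrMr // mul1r ltr_nat; lia.
have Hp : (count (fun r => p r == 0%R) l < Np)%N.
  rewrite -size_filter; apply: HNp; first by rewrite filter_uniq.
  by move=> r; rewrite mem_filter => /andP[/eqP ? /bl /andP[? ?]]; split=> //; lra.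
have Hq : (count (fun r => q r == 0%R) l < Nq)%N.
  rewrite -size_filter; apply: HNq; first by rewrite filter_uniq.
  by move=> r; rewrite mem_filter => /andP[/eqP ? /bl /andP[? ?]]; split=> //; lra.
have : (size l <= count (fun r => p r == 0%R) l + count (fun r => q r == 0%R) l)%N.
  rewrite -count_predUI; apply: leq_trans (leq_addr _ _).
  rewrite -count_predT; apply: sub_count => r _ /=.
  by rewrite -mulf_eq0 pq0.
by rewrite size_map size_iota /N => ?; exfalso; lia.
Qed.

(** * From Beurling density to blocks with many points *)

Lemma lower_beurling_density_blocks (R : realType) (beta : R) (Lambda : set R) :
  0 < beta -> ((2 * beta^-1)%:E < lower_beurling_density Lambda)%E ->
  exists n L, [/\ 0 < L, 2 * L < beta * n%:R &
    forall y, exists l : seq R,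
     [/\ uniq l, size l = n & {in l, forall t, Lambda t /\ y < t < y + L}]].
Proof.
move=> b0; rewrite /lower_beurling_density limf_einfE.
move=> /ereal_sup_gt[_ [V [M [Mr MV]] <-]] HV.
pose r := Num.max M 0 + 1.
have M1 : M <= Num.max M 0 by rewrite le_max lexx.
have M2 : 0 <= Num.max M 0 by rewrite le_max lexx orbT.
have r0 : 0 < r by rewrite /r; lra.
have Mr' : M < r by rewrite /r; lra.
(* A window of length [2 * r] has more than [4 * r / beta] points, hence at least [n]. As
   [2 * r < beta * n / 2], the midpoint [L] of these two numbers leaves room on both sides: the open
   block contains the closed window, and [2 * L < beta * n]. *)
pose n := (Num.trunc (4 * r / beta)).+1.
have nr : 4 * r < beta * n%:R by rewrite [ltRHS]mulrC -ltr_pdivrMr // truncnS_gt.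
pose L := (2 * r + beta * n%:R / 2) / 2.
exists n, L; split; [rewrite /L; lra | rewrite /L; lra|].
move=> y.
pose z := y + L / 2.
have Hz : ((2 * beta^-1)%:E <
    counting (Lambda `&` `[(z - r)%R, (z + r)%R]) * ((2 * r)^-1)%:E)%E.
  apply: lt_le_trans HV _; apply: le_trans (ereal_inf_lbound _) _.
    by exists r => //; apply: MV.
  by apply: ereal_inf_lbound; exists z.
have sub t : (Lambda `&` `[(z - r)%R, (z + r)%R]) t -> Lambda t /\ y < t < y + L.
  move=> [Lt] /=; rewrite in_itv /= => /andP[t1 t2]; split=> //.
  by apply/andP; rewrite /z /L in t1 t2 *; lra.
suff [B sB nB] : exists2 B : {fset R},
    [set` B] `<=` Lambda `&` `[(z - r)%R, (z + r)%R] & (n <= #|` B|)%N.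
  exists (take n (enum_fset B)); split; first by rewrite take_uniq // fset_uniq.
    by rewrite size_takel.
  by move=> t /mem_take tB; apply/sub/sB.
(* An infinite window contains finite subsets of any size; otherwise the count is a number and can
   be compared with [n]. *)
have [fA|/(infinite_set_fset n)//] := pselect (finite_set (Lambda `&` `[(z - r)%R, (z + r)%R])).
exists (fset_set (Lambda `&` `[(z - r)%R, (z + r)%R])); first by rewrite fset_setK.
move: Hz; rewrite /counting asboolT // -EFinM lte_fin ltr_pdivlMr ?mulr_gt0 //.
move=> Hz; rewrite truncn_lt_nat ?divr_ge0 ?mulr_ge0 ?ltW //.
by apply: le_lt_trans Hz; rewrite le_eqVlt; apply/orP; left; apply/eqP; ring.
Qed.

(** * Reduction of the complex statement to real series *)

Lemma bounded_fun_Re (R : realType) (c : int -> R[i]) :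
  bounded_fun c -> exists C, forall k, `|complex.Re (c k)| <= C.
Proof.
move=> [M [_ Mc]]; exists (complex.Re M + 1) => k.
have := Mc (M + 1) (ltr_pwDr ltr01 (lexx M)) k I.
move=> /(le_trans (normc_ge_Re _)); rewrite lecE => /andP[_] /=.
by rewrite raddfD.
Qed.

(** The Gaussian weights are real and taking real parts does not increase distances, so complex
    coefficients may be replaced by their real parts. *)
Lemma gaussian_series_Re (R : realType) (beta gamma : R) (c : int -> R[i])
    (f : R -> R[i]) :
  (forall x, partial_sum (fun k : int => c k * (gaussian gamma (x - beta * k%:~R))%:C)
                @ totally --> f x) ->
  gaussian_series beta gamma (fun k => complex.Re (c k)) (fun x => complex.Re (f x)).
Proof.
move=> cf x; apply/cvgrPdist_lt => eps eps0.
have epsC : 0 < eps%:C by rewrite ltcR.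
have /cvgrPdist_lt /(_ _ epsC) := cf x.
apply: filterS => S /=.
move=> /(le_lt_trans (normc_ge_Re _)); rewrite ltcR; congr (`|_| < _).
rewrite raddfB /=; congr (_ - _); rewrite /partial_sum raddf_sum /=.
by apply: eq_bigr => k _; case: (c _) => a b /=; rewrite mulr0 subr0.
Qed.
Lemma gaussian_seriesD (R : realType) (beta gamma : R) (c d : int -> R) (p q : R -> R) :
  gaussian_series beta gamma c p -> gaussian_series beta gamma d q ->
  gaussian_series beta gamma (c \+ d) (p \+ q).
Proof.
move=> cp dq x; rewrite [X in X @ _](_ : _ = partial_sum
  (fun k => c k * gaussian gamma (x - beta * k%:~R)) \+ partial_sum
  (fun k => d k * gaussian gamma (x - beta * k%:~R))); first exact: cvgD (cp x) (dq x).
apply/funext => S; rewrite /partial_sum /= -big_split.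
by apply: eq_bigr => k _; rewrite mulrDl.
Qed.

Lemma gaussian_seriesN (R : realType) (beta gamma : R) (c : int -> R) (p : R -> R) :
  gaussian_series beta gamma c p -> gaussian_series beta gamma (\- c) (\- p).
Proof.
move=> cp x; rewrite [X in X @ _](_ : _ = \- partial_sum
  (fun k => c k * gaussian gamma (x - beta * k%:~R))); first exact: cvgN (cp x).
by apply/funext => S; rewrite /partial_sum /= -sumrN; apply: eq_bigr => k _; rewrite mulNr.
Qed.


Theorem theorem1 (R : realType) (beta gamma : R) (Lambda : set R)
    (hbeta : 0 < beta) (hgamma : 0 < gamma)
    (hsep : separated_set Lambda)
    (hdens : ((2 * beta^-1)%:E < lower_beurling_density Lambda)%E) :
  forall f g : R -> R[i],
    shift_invariant_space beta (gaussian gamma) f ->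
    shift_invariant_space beta (gaussian gamma) g ->
    (forall x, f x \is Num.real) -> (forall x, g x \is Num.real) ->
    (forall l, Lambda l -> `|f l| = `|g l|) ->
    g = f \/ g = \- f.
Proof.
move=> f g [c cb cf] [d db dg] fr gr fg.
have [C cC] := bounded_fun_Re cb; have [D dD] := bounded_fun_Re db.
have Rf := gaussian_series_Re cf; have Rg := gaussian_series_Re dg.
have real z : z \is Num.real -> z = (complex.Re z)%:C :> R[i].
  by case: z => a b; rewrite realE !lecE /= => /orP[/andP[/eqP -> _]|/andP[/eqP <- _]].
pose p x := complex.Re (f x) - complex.Re (g x).
pose q x := complex.Re (f x) + complex.Re (g x).
have Sp : gaussian_series beta gamma (fun k => complex.Re (c k) - complex.Re (d k)) p.
  exact: gaussian_seriesD Rf (gaussian_seriesN Rg).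
have Sq : gaussian_series beta gamma (fun k => complex.Re (c k) + complex.Re (d k)) q.
  exact: gaussian_seriesD Rf Rg.
have bp k : `|complex.Re (c k) - complex.Re (d k)| <= C + D.
  by apply: le_trans (ler_normB _ _) _; apply: lerD.
have bq k : `|complex.Re (c k) + complex.Re (d k)| <= C + D.
  by apply: le_trans (ler_normD _ _) _; apply: lerD.
have [n [L [L0 Ln HL]]] := lower_beurling_density_blocks hbeta hdens.
have pq0 : forall x, p x * q x = 0.
  apply: (gaussian_series_mul_eq0 hbeta hgamma L0 Ln bp bq Sp Sq HL) => l /fg.
  (* For real values, equal moduli mean equal squares, and [p * q] is the difference of the squares
     of [f] and [g]. *)
  rewrite (real _ (fr l)) (real _ (gr l)) !normc_def /= !expr0n /= !addr0 !sqrtr_sqr.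
  move=> [] E; rewrite /p /q -subr_sqr -[X in X - _]real_normK ?num_real //.
  by rewrite E real_normK ?num_real // subrr.
have [p0|q0] := gaussian_series_integral hbeta hgamma bp bq Sp Sq pq0.
  left; apply/funext => x; rewrite (real _ (fr x)) (real _ (gr x)); congr (_%:C).
  by have := p0 x; rewrite /p; lra.
right; apply/funext => x /=; rewrite (real _ (fr x)) (real _ (gr x)) -rmorphN; congr (_%:C).
by have := q0 x; rewrite /q; lra.
Qed.
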